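(* Consider the symmetric time-slotted system of $N$ parallel queues and $K$ identical servers described in the context, with i.i.d. Bernoulli connectivities and i.i.d. Bernoulli arrivals. Then the Maximum Weighted Matching policy dominates every server assignment policy. That is: let $\pi$ be any server assignment policy, let $X=\{X(t)\}_{t\ge 1}$ be the queue length process under $\pi$, and let $X^{\mathrm{MWM}}=\{X^{\mathrm{MWM}}(t)\}_{t\ge1}$ be the queue length process under the Maximum Weighted Matching policy, both systems having the same initial queue length vector. Then for every $f\in\mathcal F$, $$\Pr\big(f(X^{\mathrm{MWM}}(t))>r\big)\le \Pr\big(f(X(t))>r\big)\qquad\text{for all } t=1,2,\dots \text{ and all } r\in\mathbb R .$$
   Context: System. Let $\mathcal N=\{1,\dots,N\}$ be a set of queues with infinite buffers and $\mathcal K=\{1,\dots,K\}$ a set of identical servers; time is slotted, $t=1,2,\dots$. The connectivity of queue $n$ to server $k$ in slot $t$ is a random variable $C_{n,k}(t)\in\{0,1\}$; the number of arrivals to queue $n$ in slot $t$ is a random variable $A_n(t)\in\{0,1\}$. The variables $C_{n,k}(t)$ ($n\in\mathcal N$, $k\in\mathcal K$, $t\ge1$) are i.i.d. Bernoulli with parameter $p$, the variables $A_n(t)$ ($n\in\mathcal N$, $t\ge 1$) are i.i.d. Bernoulli with a common parameter, and the connectivities, the arrivals and the initial queue length vector $X(0)\in\mathbb Z_+^N$ are mutually independent. Policies. A matching is a family $(I_{n,k})_{n\in\mathcal N,k\in\mathcal K}$ with $I_{n,k}\in\{0,1\}$, $\sum_{k=1}^K I_{n,k}\le 1$ for every $n$,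 and $\sum_{n=1}^N I_{n,k}\le 1$ for every $k$ ($I_{n,k}=1$ means server $k$ is assigned to queue $n$). A server assignment policy $\pi$ selects in each slot $t$ a matching $M^{(\pi)}(t)=(I^{(\pi)}_{n,k}(t))_{n,k}$ on the basis of the current connectivities $(C_{n,k}(t))_{n,k}$ and the queue length vector $X(t-1)$ at the beginning of slot $t$ (the rule may depend on $t$). Under $\pi$ the queue lengths at the end of slot $t$, $X(t)=(X_1(t),\dots,X_N(t))$, evolve as $$X_n(t)=\Big(X_n(t-1)-\sum_{k=1}^K C_{n,k}(t)I^{(\pi)}_{n,k}(t)\Big)^+ + A_n(t),\qquad n\in\mathcal N,$$ where $(y)^+=\max\{y,0\}$. Maximum Weighted Matching (MWM) policy. A policy which in every slot $t$, given the observed values $x_n(t-1)$ of its own queue lengths and $c_{n,k}(t)$ of the connectivities, uses a matching maximizing $\sum_{n=1}^N x_n(t-1)\sum_{k=1}^K c_{n,k}(t) I_{n,k}$ over all matchings $(I_{n,k})$. Order and cost functions. For $x,\tilde x\in\mathbb Z_+^N$ write $\tilde x\preceq x$ if one of the following holds: (D1) $\tilde x_n\le x_n$ for all $n$; (D2) $\tilde x$ is obtained from $x$ by exchanging the entries in two distinct positions $n,m$, i.e. $\tilde x_n=x_m$, $\tilde x_m=x_n$, all other entries equal; (D3) $\tilde x$ and $x$ differ only in two positions $n,m$, with $\tilde x_n=x_n+1$, $\tilde x_m=x_m-1$ and $x_n<\tilde x_n\le\tilde x_m<x_m$. Let $\preceq_p$ be the transitive closure of $\preceq$. The class $\mathcal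 F$ consists of all functions $f:\mathbb Z_+^N\to\mathbb R$ such that $\tilde x\preceq_p x$ implies $f(\tilde x)\le f(x)$. *)

(* Defs.v *)
From Stdlib Require Import Relation_Operators.
From HB Require Import structures.
From mathcomp Require Import all_boot all_order all_algebra finmap.
From mathcomp Require Import all_classical all_reals all_analysis.

Set Implicit Arguments.
Unset Strict Implicit.
Unset Printing Implicit Defensive.

Import Order.TTheory GRing.Theory Num.Theory.

Local Open Scope classical_set_scope.

(* Mutual independence of the families of events (E i), i ranging over D. *)
Definition mutually_independent d (T : measurableType d) (R : realType)
    (P : probability T R) (I : choiceType) (D : set I)
    (E : I -> set (set T)) : Prop :=
  forall (J : {fset I}) (B : I -> set T),
    [set` J] `<=` D -> (forall i, i \in J -> E i (B i)) ->
    P (\bigcap_(i in [set` J]) B i) = (\prod_(i <- J) P (B i))%E.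

Section queueing_system.
Variables N K : nat.
Local Open Scope nat_scope.

(* Queue length vectors are N.-tuple nat, because the library equips tuples
   with the product sigma-algebra, which here contains every subset.
   Connectivities c and matchings I are boolean matrices, with rows indexed by
   queues and columns by servers; bool coerces to {0, 1} in nat. *)
Definition is_matching (I : 'M[bool]_(N, K)) : Prop :=
  (forall n, \sum_(k < K) I n k <= 1) /\ (forall k, \sum_(n < N) I n k <= 1).

Definition policy := nat -> 'M[bool]_(N, K) -> N.-tuple nat -> 'M[bool]_(N, K).

(* Slots are numbered from 1. *)
Definition is_server_assignment (pi : policy) : Prop :=
  forall t c x, 0 < t -> is_matching (pi t c x).

Definition matching_weight (c : 'M[bool]_(N, K)) (x : N.-tuple nat)
    (I : 'M[bool]_(N, K)) : nat :=
  \sum_(n < N) tnth x n * \sum_(k < K) c n k * I n k.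

(* Ties between matchings of maximum weight are broken arbitrarily. *)
Definition is_MWM (pi : policy) : Prop :=
  forall t c x, 0 < t ->
    is_matching (pi t c x) /\
    forall I, is_matching I ->
      matching_weight c x I <= matching_weight c x (pi t c x).

(* The truncated subtraction of nat is the positive part of the difference. *)
Definition next_queues (x : N.-tuple nat) (c I : 'M[bool]_(N, K))
    (a : 'I_N -> bool) : N.-tuple nat :=
  [tuple (tnth x n - \sum_(k < K) c n k * I n k) + a n | n < N].

(* c t and a t are the connectivities and the arrivals of slot t (t >= 1);
   queues pi x0 c a t is the queue length vector at the end of slot t. *)
Fixpoint queues (pi : policy) (x0 : N.-tuple nat) (c : nat -> 'M[bool]_(N, K))
    (a : nat -> 'I_N -> bool) (t : nat) : N.-tuple nat :=
  if t is s.+1 then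
    let x := queues pi x0 c a s in
    next_queues x (c s.+1) (pi s.+1 (c s.+1) x) (a s.+1)
  else x0.

Definition queue_process (T : Type) (pi : policy) (X0 : T -> N.-tuple nat)
    (C : 'I_N -> 'I_K -> nat -> T -> bool) (A : 'I_N -> nat -> T -> bool)
    (t : nat) (w : T) : N.-tuple nat :=
  queues pi (X0 w) (fun s => \matrix_(n, k) C n k s w)%R (fun s n => A n s w) t.

(* Indices of the primitive random variables: C_{n,k}(t), A_n(t) and X(0). *)
Definition source : Type := (('I_N * 'I_K * nat) + ('I_N * nat) + unit)%type.

(* The families C and A are indexed by all of nat, but the system only involves
   the slots t >= 1, so nothing is assumed about their entries at t = 0. *)
Definition valid_source : set source :=
  fun s => match s with
           | inl (inl (_, _, t)) => 0 < t
           | inl (inr (_, t)) => 0 < t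
           | inr _ => true
           end.

Definition source_events d (T : measurableType d)
    (X0 : T -> N.-tuple nat) (C : 'I_N -> 'I_K -> nat -> T -> bool)
    (A : 'I_N -> nat -> T -> bool) (s : source) : set (set T) :=
  match s with
  | inl (inl (n, k, t)) => g_sigma_algebra_preimage (C n k t)
  | inl (inr (n, t)) => g_sigma_algebra_preimage (A n t)
  | inr _ => g_sigma_algebra_preimage X0
  end.

Definition dominated (y x : N.-tuple nat) : Prop :=
  forall n, tnth y n <= tnth x n.

Definition swapped (y x : N.-tuple nat) : Prop :=
  exists n m : 'I_N, [/\ n != m, tnth y n = tnth x m, tnth y m = tnth x n &
    forall l, l != n -> l != m -> tnth y l = tnth x l].

Definition balanced (y x : N.-tuple nat) : Prop :=
  exists n m : 'I_N, [/\ n != m,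
    forall l, l != n -> l != m -> tnth y l = tnth x l,
    tnth y n = tnth x n + 1, tnth y m = tnth x m - 1 &
    tnth x n < tnth y n /\ tnth y n <= tnth y m /\ tnth y m < tnth x m].

Definition preceq (y x : N.-tuple nat) : Prop :=
  [\/ dominated y x, swapped y x | balanced y x].

Definition preceq_p : N.-tuple nat -> N.-tuple nat -> Prop :=
  @clos_trans (N.-tuple nat) preceq.

Definition cost_function (R : realType) (f : N.-tuple nat -> R) : Prop :=
  forall y x, preceq_p y x -> (f y <= f x)%R.

End queueing_system.

Arguments valid_source {N K}.

(* Main.v *)
(* A cost function f can be replaced by the indicator g of {f > r}, which is
   again a cost function, so it suffices to compare expectations of cost
   functions, slot by slot. Given the connectivities of a slot, the sets of
   queues that a matching can serve are the independent sets of a transversal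
   matroid; symmetric exchange turns the set served by any matching into the one
   served by a matching of maximum weight, each exchange being a step (D2) or
   (D3) downwards, so MWM minimizes the conditional expectation of g in the slot.
   Moreover averaging g over the arrivals of a slot, or over its connectivities
   under MWM, yields a cost function: (D1) and (D3) are preserved for each
   outcome, because MWM is at least as good as copying the decisions taken in the
   larger state, and (D2) by exchangeability of the queues. Induction on the
   horizon then compares the policies for a fixed initial vector; independence
   makes the law of X(t) the mixture of these finite averages over X(0). *)
Require Import Defs.
From mathcomp Require Import all_boot all_order all_algebra perm finmap.
From mathcomp Require Import all_classical all_reals all_analysis.
From mathcomp Require Import measurable_realfun zify.

Set Implicit Arguments.
Unset Strict Implicit.
Unset Printing Implicit Defensive.

Import Order.TTheory GRing.Theory Num.Theory.

Local Open Scope ring_scope.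

(** * Symmetric exchange of matchings *)

Section matchings.
Local Open Scope nat_scope.
Variables (U V : finType) (E : U -> V -> bool).
Implicit Types (I M : U -> option V) (n m : U).

(** A matching is recorded from the side of the queues, so that [I] read as a boolean predicate is
    the set of queues served. *)
Definition partial_matching I : Prop :=
  (forall n k, I n = Some k -> E n k) /\
  (forall n m k, I n = Some k -> I m = Some k -> n = m).

(** The hypothesis leaves [m] as the only possible holder of [k], so handing [k] to [n] creates no
    conflict. Taking [m := n] covers a server that nobody holds. *)
Lemma partial_matching_move I n m k :
  partial_matching I -> (forall l, I l = Some k -> l = m) -> E n k ->
  partial_matching
    (fun l => if l == n then Some k else if l == m then None else I l).
Proof.
move=> [IE Iinj] Ik Enk; split=> [l j|l1 l2 j].
  case: (l =P n) => [-> [<-] //|_]; case: (l =P m) => // _; exact: IE.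
case: (l1 =P n) => [->|_]; case: (l2 =P n) => [->|_] //.
- by move=> [<-]; case: (l2 =P m) => // + /Ik.
- by case: (l1 =P m) => // + + [?]; subst j => + /Ik.
- by case: (l1 =P m) => // _; case: (l2 =P m) => // _; exact: Iinj.
Qed.

(* Symmetric exchange along the alternating path of I and M issued from n. The
   last clause, that I' keeps what I and M share, is what the induction along
   this path needs. *)
Lemma partial_matching_exchange I M n :
  partial_matching I -> partial_matching M -> I n -> ~~ M n ->
  (exists2 M', partial_matching M' & forall l, M' l = (l == n) || M l :> bool)
  \/ exists n' M' I',
    [/\ M n', ~~ I n' , partial_matching M' /\ partial_matching I',
        (forall l, M' l = (l == n) || (l != n') && M l :> bool) /\
        (forall l, I' l = (l == n') || (l != n) && I l :> bool)
      & forall l, I l = M l -> I' l = I l].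
Proof.
(* Induction on the number of queues on which [I] and [M] disagree. *)
have [d] := ubnP #|[set l | I l != M l]|.
elim: d => // d IHd in M n *; rewrite ltnS => dIM mI mM In Mn.
case Ink: (I n) In => [k|] // _; have Enk := mI.1 _ _ Ink.
(* If the server [k] that [I] gives to [n] is free in [M], the path ends there and augments [M].
   Otherwise it continues to the holder [n1] of [k] in [M]. *)
have [/existsP[n1 /eqP Mn1]|/existsPn Mk] := boolP [exists l, M l == Some k];
    last first.
  left.
  exists (fun l => if l == n then Some k else if l == n then None else M l).
    by apply: partial_matching_move => // l Ml; move: (Mk l); rewrite Ml eqxx.
  by move=> l; case: (l =P n).
have n1n : n1 != n by apply: contraNneq Mn => <-; rewrite Mn1.
pose M1 l := if l == n then Some k else if l == n1 then None else M l.
have mM1 : partial_matching M1.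
  by apply: partial_matching_move => // l Ml; exact: (mM.2 _ _ _ Ml Mn1).
have M1E l : M1 l = (l == n) || (l != n1) && M l :> bool.
  by rewrite /M1; case: (l =P n) => //= _; case: (l =P n1).
(* The move opposite to [M1]: [k] passes from [n] to [n1]. When [I] does not serve [n1], the path
   ends and [n' = n1]. *)
pose moved I0 l := if l == n1 then Some k else if l == n then None else I0 l.
have [In1|In1] := boolP (I n1 : bool); last first.
  right; exists n1, M1, (moved I); split; rewrite ?Mn1 //.
  - split=> //; apply: partial_matching_move => //; last exact: mM.1 Mn1.
    by move=> l Il; exact: (mI.2 _ _ _ Il Ink).
  - split=> // l; rewrite /moved.
    by case: (l =P n1) => //= _; case: (l =P n).
  - move=> l IM; rewrite /moved.
    case: (l =P n1) => [El|_]; first by move: In1; rewrite -El IM El Mn1.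
    by case: (l =P n) => // El; move: Mn; rewrite -El -IM El Ink.
have M1n1 : ~~ M1 n1 by rewrite M1E (negPf n1n) eqxx.
(* [M1] now agrees with [I] at [n], while [n1] was already a disagreement because [I] gives [k] to
   [n] only. *)
have dM1 : #|[set l | I l != M1 l]| < d.
  apply: leq_trans dIM; apply: proper_card; apply/properP; split.
    apply/fintype.subsetP => l; rewrite !inE /M1.
    case: (l =P n) => [->|_]; first by rewrite Ink eqxx.
    case: (l =P n1) => [-> _|//]; rewrite Mn1.
    by apply/eqP => /(mI.2 _ _ _ Ink)/eqP; rewrite eq_sym (negPf n1n).
  exists n; rewrite !inE /M1 ?eqxx Ink ?eqxx //.
  by case: (M n) Mn.
case: (IHd M1 n1 dM1 mI mM1 In1 M1n1) => [[M' mM' M'E]|].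
  left; exists M' => // l; rewrite M'E M1E.
  by case: (l =P n1) => [->|//]; rewrite Mn1 /= orbT.
move=> [n' [M' [I' [M1n' In' [mM' mI'] [M'E I'E] I'I]]]].
have n'n : n' != n by apply: contraNneq In' => ->; rewrite Ink.
have n'n1 : n' != n1 by apply: contraNneq In' => ->.
(* Since [I] and [M1] agree at [n], the recursive exchange leaves [k] with [n], and [moved] can then
   pass it to [n1]. *)
have I'n : I' n = Some k by rewrite I'I ?Ink // /M1 eqxx.
right; exists n', M', (moved I'); split=> //.
- by move: M1n'; rewrite M1E (negPf n'n) n'n1.
- split=> //; apply: partial_matching_move => //; last exact: mM.1 Mn1.
  by move=> l Il; exact: (mI'.2 _ _ _ Il I'n).
- split=> l; first rewrite M'E M1E.
    case: (l =P n1) => [->|_] /=.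
      by rewrite Mn1 (negPf n1n) /= eq_sym n'n1.
    by case: (l =P n) => [->|//] /=; rewrite eq_sym n'n.
  rewrite /moved; case: (l =P n1) => [->|/eqP ln1] /=.
    by rewrite In1 n1n orbT.
  case: (l =P n) => [->|_] /=; first by rewrite eq_sym (negPf n'n).
  by rewrite I'E ln1.
- move=> l IM; rewrite /moved.
  case: (l =P n1) => [El|/eqP ln1].
    move: IM; rewrite El Mn1 => /(mI.2 _ _ _ Ink)/eqP.
    by rewrite eq_sym (negPf n1n).
  case: (l =P n) => [El|/eqP ln]; first by move: Mn; rewrite -El -IM El Ink.
  by apply: I'I; rewrite /M1 (negPf ln) (negPf ln1).
Qed.
End matchings.

(** * Cost functions and one slot of service *)

Section order.
Local Open Scope nat_scope.
Variables (R : realType) (N : nat).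
Implicit Types (x y : N.-tuple nat) (g : N.-tuple nat -> R) (s : 'I_N -> bool).

Definition depart x s : N.-tuple nat := [tuple tnth x n - s n | n < N].

Definition arrive x s : N.-tuple nat := [tuple tnth x n + s n | n < N].

(** A form of (D1), (D2), (D3) on two positions that is boolean and free of subtraction, so that
    case analyses end with [lia]. *)
Lemma preceq_pair y x (n m : 'I_N) : n != m ->
  (forall l, l != n -> l != m -> tnth y l = tnth x l) ->
  [|| (tnth y n <= tnth x n) && (tnth y m <= tnth x m),
      (tnth y n == tnth x m) && (tnth y m == tnth x n)
    | [&& tnth y n == (tnth x n).+1, (tnth y m).+1 == tnth x m
        & tnth y n <= tnth y m]] ->
  preceq y x.
Proof.
move=> nm yx.
move=> /or3P[/andP[yn ym]|/andP[/eqP yn /eqP ym]|/and3P[/eqP yn /eqP ym ynm]].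
- constructor 1 => l; have [->//|ln] := eqVneq l n.
  by have [->//|lm] := eqVneq l m; rewrite yx.
- by constructor 2; exists n, m; split.
- by constructor 3; exists n, m; split=> //; lia.
Qed.

Lemma cost_function_preceq g :
  (forall y x, preceq y x -> (g y <= g x)%R) -> cost_function g.
Proof.
by move=> gP y x; elim=> [y' x' /gP//|y' z x' _ yz _]; exact: le_trans yz.
Qed.

Lemma preceq_cost g y x : cost_function g -> preceq y x -> (g y <= g x)%R.
Proof. by move=> gF yx; apply: gF; exact: Relation_Operators.t_step. Qed.

(** The type of the step can change: serving only [m] when [y] is equal at [n] and [m] yields (D2),
    and serving [n] when it is empty in [x] yields (D1). *)
Lemma balanced_depart y x s : balanced y x ->
  preceq (depart y s) (depart x s).
Proof.
move=> [n [m [nm yx yn ym [xyn [ynm yxm]]]]].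
apply: (preceq_pair nm) => [l ln lm|]; rewrite !tnth_mktuple.
  by rewrite yx.
by case: (s n); case: (s m); lia.
Qed.

(** The step stays (D3), except that an arrival to [n] alone yields (D2) when [y] is equal at [n]
    and [m]. *)
Lemma balanced_arrive y x s : balanced y x ->
  preceq (arrive y s) (arrive x s).
Proof.
move=> [n [m [nm yx yn ym [xyn [ynm yxm]]]]].
apply: (preceq_pair nm) => [l ln lm|]; rewrite !tnth_mktuple.
  by rewrite yx.
by case: (s n); case: (s m); lia.
Qed.

(** Induction on the number of nonempty queues served by [I] and not by [M]. If there is none, [M]
    does at least as well queue by queue, which is (D1); otherwise an exchange removes one of them
    without raising the cost. *)
Lemma max_weight_depart (V : finType) (E : 'I_N -> V -> bool) g x
    (M I : 'I_N -> option V) : cost_function g ->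
  partial_matching E M ->
  (forall J, partial_matching E J ->
    \sum_n tnth x n * J n <= \sum_n tnth x n * M n) ->
  partial_matching E I -> (g (depart x M) <= g (depart x I))%R.
Proof.
move=> gF mM maxM.
have [d] := ubnP #|[set n | [&& I n : bool, ~~ M n & 0 < tnth x n]]|.
elim: d => // d IHd in I *; rewrite ltnS => dI mI.
have [IM|[n]] := set_0Vmem [set n | [&& I n : bool, ~~ M n & 0 < tnth x n]].
  apply: preceq_cost => //; constructor 1 => l; rewrite !tnth_mktuple.
  have /finset.setP/(_ l) := IM; rewrite !inE.
  by case: (I l : bool); case: (M l : bool); lia.
rewrite inE => /and3P[In Mn xn].
(* An augmentation of [M] by the nonempty queue [n] would have larger weight. *)
have [[M' mM' M'E]|] := partial_matching_exchange mI mM In Mn.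
  have := maxM _ mM'; rewrite (bigD1 n) //= [leqRHS](bigD1 n) //= M'E eqxx.
  rewrite (negPf Mn); under eq_bigr => l ln do rewrite M'E (negPf ln) /=.
  lia.
move=> [n' [M' [I' [Mn' In' [mM' mI'] [M'E I'E] _]]]].
have n'n : n' != n by apply: contraNneq In' => ->.
have nn' : n != n' by rewrite eq_sym.
(* [M'] serves [n] in place of [n'], so maximality of [M] compares the two lengths. *)
have xnn' : tnth x n <= tnth x n'.
  have := maxM _ mM'; rewrite (bigD1 n) //= [leqRHS](bigD1 n) //=.
  rewrite (bigD1 n') //= [X in _ <= _ + X](bigD1 n') //= !M'E !eqxx.
  rewrite (negPf Mn) Mn' (negPf n'n) /=.
  by under eq_bigr => l /andP[/negPf ln ln'] do rewrite M'E ln ln' /=; lia.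
apply: le_trans (IHd I' _ mI') _.
  apply: leq_trans dI; apply: proper_card; apply/properP; split.
    apply/fintype.subsetP => l; rewrite !inE I'E.
    by case: (l =P n') => [->|_]; [rewrite Mn' | case: (l == n)].
  by exists n; rewrite !inE ?In ?Mn // I'E eqxx (negPf nn').
(* Shifting service from [n] to [n'] is a step (D2) if the two lengths are equal and (D3) if [n'] is
   longer. *)
apply: preceq_cost => //; apply: (preceq_pair nn') => [l ln ln'|].
  by rewrite !tnth_mktuple I'E (negPf ln') ln.
rewrite !tnth_mktuple !I'E !eqxx (negPf nn') In (negPf In') /=; lia.
Qed.

End order.

(** * Matchings as boolean matrices *)

Section service.
Local Open Scope nat_scope.
Variables (R : realType) (N K : nat).
Implicit Types (c I : 'M[bool]_(N, K)) (x : N.-tuple nat).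

Definition departures c I : 'I_N -> bool := fun n => [exists k, c n k && I n k].

Lemma sum_bool_le1 (V : finType) (b : V -> bool) : \sum_k b k <= 1 ->
  \sum_k b k = [exists k, b k] /\
  forall k j, b k -> b j -> k = j.
Proof.
move=> b1; split.
  have [/existsP[k bk]|/existsPn b0] := boolP [exists k, b k].
    by move: b1; rewrite (bigD1 k) //= bk; lia.
  by rewrite big1 // => k _; rewrite (negPf (b0 k)).
move=> k j bk bj; apply/eqP; move: b1; rewrite (bigD1 k) //= bk.
by apply: contraTT => kj; rewrite (bigD1 j) /= 1?eq_sym // bj; lia.
Qed.

Lemma departuresE c I n : is_matching I ->
  \sum_(k < K) c n k * I n k = departures c I n.
Proof.
move=> [+ _] => /(_ n) In.
under eq_bigr => k _ do rewrite mulnb.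
by apply: (sum_bool_le1 _).1; apply: leq_trans In; apply: leq_sum => k _;
  case: (c n k).
Qed.

(** An assignment to a disconnected server serves nothing and is dropped, which leaves a matching in
    the connectivity graph. *)
Definition matching_of_mx c I n : option 'I_K := [pick k | c n k && I n k].

Definition mx_of_matching (mu : 'I_N -> option 'I_K) : 'M[bool]_(N, K) :=
  \matrix_(n, k) (mu n == Some k).

Lemma matching_of_mxE c I n : matching_of_mx c I n = departures c I n :> bool.
Proof.
rewrite /matching_of_mx /departures; case: pickP => [k ck|c0] /=.
  by symmetry; apply/existsP; exists k.
by symmetry; apply/existsP => -[k ck]; move: (c0 k); rewrite /= ck.
Qed.

Lemma partial_matching_of_mx c I : is_matching I ->
  partial_matching (fun n k => c n k) (matching_of_mx c I).
Proof.
move=> [_ Ik]; rewrite /matching_of_mx; split=> [n k|n m k].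
  by case: pickP => // j /andP[cj _] [<-].
case: pickP => // j /andP[_ Inj] [<-]; case: pickP => // l /andP[_ Iml] [lj].
by apply: (sum_bool_le1 (Ik j)).2 => //; rewrite -lj.
Qed.

Lemma is_matching_mx_of c mu : partial_matching (fun n k => c n k) mu ->
  is_matching (mx_of_matching mu).
Proof.
move=> [muc muinj]; split=> [n|k]; under eq_bigr do rewrite mxE.
  case: (mu n) => [k|]; last by rewrite big1.
  rewrite (bigD1 k) //= eqxx big1 // => j /negPf jk.
  by case: eqP => // -[kj]; rewrite kj eqxx in jk.
have [/existsP[n /eqP nk]|/existsPn nk] := boolP [exists n, mu n == Some k].
  rewrite (bigD1 n) //= nk eqxx big1 // => m /negPf mn; case: eqP => // mk.
  by rewrite (muinj _ _ _ mk nk) eqxx in mn.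
by rewrite big1 // => n _; rewrite (negPf (nk n)).
Qed.

Lemma departures_mx_of c mu n : partial_matching (fun n k => c n k) mu ->
  departures c (mx_of_matching mu) n = mu n :> bool.
Proof.
move=> [muc _]; case mun: (mu n) => [k|] /=.
  by apply/existsP; exists k; rewrite mxE mun eqxx (muc _ _ mun).
by apply/existsP => -[k]; rewrite mxE mun andbF.
Qed.

Lemma matching_weightE c x I : is_matching I ->
  matching_weight c x I = \sum_n tnth x n * departures c I n.
Proof. by move=> mI; apply: eq_bigr => n _; rewrite departuresE. Qed.

Definition is_max_matching c x I : Prop :=
  is_matching I /\
  forall J, is_matching J -> matching_weight c x J <= matching_weight c x I.

(** Weights and departures depend only on the set of queues served, which the translations between
    matrices and partial matchings preserve. *)
Lemma max_matching_optimal (g : N.-tuple nat -> R) c x M I :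
  cost_function g -> is_max_matching c x M -> is_matching I ->
  (g (depart x (departures c M)) <= g (depart x (departures c I)))%R.
Proof.
move=> gF [mM maxM] mI.
have dE J : depart x (departures c J) = depart x (matching_of_mx c J).
  by apply: eq_from_tnth => n; rewrite !tnth_mktuple matching_of_mxE.
rewrite !dE; apply: (max_weight_depart gF).
- exact: partial_matching_of_mx.
- move=> J mJ; have mJ' := is_matching_mx_of mJ.
  have := maxM _ mJ'; rewrite !matching_weightE //.
  by under eq_bigr do rewrite departures_mx_of //;
    under [leqRHS]eq_bigr do rewrite -matching_of_mxE.
- exact: partial_matching_of_mx.
Qed.
End service.

(** * Averages of cost functions over arrivals and connectivities *)

Section averaging.
Variables (R : realType) (N K : nat) (p q : R).
Hypotheses (p01 : 0 <= p <= 1) (q01 : 0 <= q <= 1).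
Implicit Types (x y : N.-tuple nat) (g : N.-tuple nat -> R).

Definition arrival_weight (a : {ffun 'I_N -> bool}) : R :=
  \prod_n bernoulli_pmf q (a n).

Definition connectivity_weight (c : 'M[bool]_(N, K)) : R :=
  \prod_n \prod_k bernoulli_pmf p (c n k).

Lemma arrival_weight_ge0 a : 0 <= arrival_weight a.
Proof. by apply: prodr_ge0 => n _; exact: bernoulli_pmf_ge0. Qed.

Lemma connectivity_weight_ge0 c : 0 <= connectivity_weight c.
Proof.
by apply: prodr_ge0 => n _; apply: prodr_ge0 => k _; exact: bernoulli_pmf_ge0.
Qed.

Lemma cost_tperm g x y (n m : 'I_N) : cost_function g ->
  (forall l, tnth y l = tnth x (tperm n m l)) -> g y <= g x.
Proof.
move=> gF yx; have [nm|nm] := eqVneq n m.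
  by have -> : y = x by apply: eq_from_tnth => l; rewrite yx nm tperm1 perm1.
apply: preceq_cost => //; constructor 2; exists n, m.
split=> // [||l ln lm]; rewrite yx ?tpermL ?tpermR// tpermD// eq_sym //.
Qed.

Lemma cost_arrivals g : cost_function g -> cost_function
  (fun x => \sum_(a : {ffun 'I_N -> bool}) arrival_weight a * g (arrive x a)).
Proof.
move=> gF; apply: cost_function_preceq => y x [yx|[n [m [nm yn ym yx]]]|yx].
- apply: ler_sum => a _; apply: ler_wpM2l; first exact: arrival_weight_ge0.
  apply: preceq_cost => //; constructor 1 => l.
  by rewrite !tnth_mktuple leq_add2r.
(* Exchanging the arrivals of [n] and [m] along with their lengths keeps the weight, because all
   queues share the parameter [q]. *)
- pose s (a : {ffun 'I_N -> bool}) := [ffun l => a (tperm n m l)].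
  have sK : involutive s by move=> a; apply/ffunP => l; rewrite !ffunE tpermK.
  rewrite (reindex_inj (inv_inj sK)); apply: ler_sum => a _.
  have -> : arrival_weight (s a) = arrival_weight a.
    rewrite /arrival_weight [RHS](reindex_inj (@perm_inj _ (tperm n m))).
    by apply: eq_bigr => l _; rewrite ffunE.
  apply: ler_wpM2l; first exact: arrival_weight_ge0.
  apply: (@cost_tperm _ _ _ n m) => // l; rewrite !tnth_mktuple ffunE.
  by congr (_ + _)%N; case: tpermP => [->|->|/eqP ln /eqP lm] //; exact: yx.
- apply: ler_sum => a _; apply: ler_wpM2l; first exact: arrival_weight_ge0.
  by apply: preceq_cost => //; exact: balanced_arrive.
Qed.

Lemma is_matching_row_perm (s : {perm 'I_N}) (I : 'M[bool]_(N, K)) :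
  is_matching I -> is_matching (row_perm s I).
Proof.
move=> [In Ik]; split=> [n|k]; under eq_bigr do rewrite mxE; first exact: In.
by apply: leq_trans (Ik k); rewrite [leqRHS](reindex_inj (@perm_inj _ s)).
Qed.

Lemma cost_services g
    (mu : 'M[bool]_(N, K) -> N.-tuple nat -> 'M[bool]_(N, K)) :
  cost_function g -> (forall c x, is_max_matching c x (mu c x)) ->
  cost_function (fun x => \sum_(c : 'M[bool]_(N, K))
    connectivity_weight c * g (depart x (departures c (mu c x)))).
Proof.
move=> gF mumax; have mum c x : is_matching (mu c x) := (mumax c x).1.
(* It suffices to let [y] copy the matching chosen for [x]: the maximum matching for [y] costs no
   more. *)
have pointwise y x :
    (forall c, g (depart y (departures c (mu c x))) <=
               g (depart x (departures c (mu c x)))) ->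
    \sum_(c : 'M[bool]_(N, K))
      connectivity_weight c * g (depart y (departures c (mu c y))) <=
    \sum_(c : 'M[bool]_(N, K))
      connectivity_weight c * g (depart x (departures c (mu c x))).
  move=> gyx; apply: ler_sum => c _.
  apply: ler_wpM2l; first exact: connectivity_weight_ge0.
  by apply: le_trans (gyx c); exact: max_matching_optimal.
apply: cost_function_preceq => y x [yx|[n [m [nm yn ym yx]]]|yx].
- apply: pointwise => c; apply: preceq_cost => //.
  by constructor 1 => l; rewrite !tnth_mktuple leq_sub2r.
- pose s (c : 'M[bool]_(N, K)) := row_perm (tperm n m) c.
  have sK : involutive s by move=> c; apply/matrixP => l k; rewrite !mxE tpermK.
  rewrite (reindex_inj (inv_inj sK)); apply: ler_sum => c _.
  have -> : connectivity_weight (s c) = connectivity_weight c.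
    rewrite /connectivity_weight [RHS](reindex_inj (@perm_inj _ (tperm n m))).
    by apply: eq_bigr => l _; apply: eq_bigr => k _; rewrite mxE.
  apply: ler_wpM2l; first exact: connectivity_weight_ge0.
  (* With the rows of the connectivities exchanged, the matching chosen for [x] with its rows
     exchanged is a competitor in state [y], and it serves the exchanged queues. *)
  apply: le_trans
    (max_matching_optimal gF (mumax _ _) (is_matching_row_perm _ (mum c x))) _.
  apply: (@cost_tperm _ _ _ n m) => // l; rewrite !tnth_mktuple.
  congr (_ - _)%N.
    by case: tpermP => [->|->|/eqP ln /eqP lm] //; exact: yx.
  by congr (nat_of_bool _); apply: eq_existsb => k; rewrite !mxE.
- by apply: pointwise => c; apply: preceq_cost => //; exact: balanced_depart.
Qed.

End averaging.

(** * Comparison of policies over finite histories *)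

Notation slot N K := ('M[bool]_(N, K) * {ffun 'I_N -> bool})%type.

Section dynamic_programming.
Variables (R : realType) (N K : nat) (p q : R).
Hypotheses (p01 : 0 <= p <= 1) (q01 : 0 <= q <= 1).
Implicit Types (x y : N.-tuple nat) (g : N.-tuple nat -> R) (pi : policy N K).

Local Notation slot := (slot N K).

Implicit Types (b : slot) (h : seq slot).

Definition slot_weight b : R :=
  connectivity_weight p b.1 * arrival_weight q b.2.

Lemma slot_weight_ge0 b : 0 <= slot_weight b.
Proof.
apply: mulr_ge0; first exact: connectivity_weight_ge0.
exact: arrival_weight_ge0.
Qed.

(* A history lists its most recent slot first, and slots are numbered from 1. *)
Definition slot_of h (j : nat) : slot :=
  nth (const_mx false, [ffun=> false]) h (size h - j).

Arguments slot_of : simpl never.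

Definition run pi x h : N.-tuple nat :=
  queues pi x (fun s => (slot_of h s).1) (fun s => (slot_of h s).2) (size h).

Definition step pi (t : nat) x b : N.-tuple nat :=
  next_queues x b.1 (pi t b.1 x) b.2.

(** Only slots 1 to [t] matter, so the default value that [slot_of] returns for slot 0 is
    harmless. *)
Lemma eq_queues pi x c c' a a' t :
  (forall s, (0 < s <= t)%N -> c s = c' s) ->
  (forall s, (0 < s <= t)%N -> a s =1 a' s) ->
  queues pi x c a t = queues pi x c' a' t.
Proof.
elim: t => //= t IHt cc' aa'.
rewrite IHt => [|s /andP[s0 st]|s /andP[s0 st]]; last 2 first.
- by apply: cc'; rewrite s0 ltnW.
- by apply: aa'; rewrite s0 ltnW.
rewrite cc' ?leqnn //; apply: eq_from_tnth => n.
by rewrite !tnth_mktuple aa' ?leqnn.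
Qed.

Lemma run_cons pi x b h :
  run pi x (b :: h) = step pi (size h).+1 (run pi x h) b.
Proof.
have slot_cons s : (0 < s <= size h)%N -> slot_of (b :: h) s = slot_of h s.
  by case/andP=> s0 sh; rewrite /slot_of /= subSn.
have slot_last : slot_of (b :: h) (size h).+1 = b by rewrite /slot_of /= subnn.
rewrite /run /= slot_last; congr (step pi _ _ b).
by apply: eq_queues => s sh; rewrite slot_cons.
Qed.

Lemma next_queuesE x (c I : 'M[bool]_(N, K)) (a : 'I_N -> bool) :
  is_matching I ->
  next_queues x c I a = arrive (depart x (departures c I)) a.
Proof.
by move=> mI; apply: eq_from_tnth => n; rewrite !tnth_mktuple departuresE.
Qed.

(** The transition operator of slot [t] under [pi], acting on functions of the state. *)
Definition expect_step pi (t : nat) g x : R :=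
  \sum_(b : slot) slot_weight b * g (step pi t x b).

Definition arrival_mean g x : R :=
  \sum_(a : {ffun 'I_N -> bool}) arrival_weight q a * g (arrive x a).

(** The matching does not depend on the arrivals of the slot, so these are averaged first and
    service acts on the averaged function. *)
Lemma expect_stepE pi t g x : is_server_assignment pi -> (0 < t)%N ->
  expect_step pi t g x = \sum_(c : 'M[bool]_(N, K)) connectivity_weight p c *
    arrival_mean g (depart x (departures c (pi t c x))).
Proof.
move=> pim t0; rewrite /expect_step.
under [RHS]eq_bigr do rewrite mulr_sumr.
rewrite pair_bigA /=; apply: eq_bigr => -[c a] _ /=.
by rewrite /step next_queuesE ?mulrA //; exact: pim.
Qed.

Lemma is_MWM_server_assignment mwm :
  @is_MWM N K mwm -> is_server_assignment mwm.
Proof. by move=> mwmP t c x t0; case: (mwmP t c x t0). Qed.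

Lemma expect_step_cost mwm t g : @is_MWM N K mwm -> (0 < t)%N ->
  cost_function g -> cost_function (expect_step mwm t g).
Proof.
move=> mwmP t0 gF.
have -> : expect_step mwm t g = fun x => \sum_(c : 'M[bool]_(N, K))
    connectivity_weight p c *
    arrival_mean g (depart x (departures c (mwm t c x))).
  apply/funext => x; rewrite expect_stepE //.
  exact: is_MWM_server_assignment.
apply: (@cost_services _ _ _ _ p01 (arrival_mean g) (mwm t)) => [|c x].
  exact: cost_arrivals.
exact: mwmP.
Qed.

Lemma expect_step_optimal mwm pi t g x :
  @is_MWM N K mwm -> is_server_assignment pi -> (0 < t)%N -> cost_function g ->
  expect_step mwm t g x <= expect_step pi t g x.
Proof.
move=> mwmP pim t0 gF.
rewrite !expect_stepE //; last exact: is_MWM_server_assignment.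
apply: ler_sum => c _; apply: ler_wpM2l; first exact: connectivity_weight_ge0.
apply: max_matching_optimal; [exact: cost_arrivals|exact: mwmP|exact: pim].
Qed.

Definition history_weight h : R := \prod_(b <- h) slot_weight b.

Lemma history_weight_ge0 h : 0 <= history_weight h.
Proof. by apply: prodr_ge0 => b _; exact: slot_weight_ge0. Qed.

Lemma sum_tupleS (V : nmodType) (X : finType) t (F : seq X -> V) :
  \sum_(h : t.+1.-tuple X) F h = \sum_(h : t.-tuple X) \sum_b F (b :: h).
Proof.
rewrite exchange_big pair_bigA /=.
rewrite (reindex (fun bh : X * t.-tuple X => cons_tuple bh.1 bh.2)) //=.
exists (fun h : t.+1.-tuple X => (thead h, behead_tuple h)) => [[b h] _|h _] /=.
  by congr (_, _); apply: val_inj.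
by apply: val_inj => /=; rewrite [in RHS](tuple_eta h).
Qed.

(** Conditioning on all slots but the last, which is the head of the history. *)
Lemma expect_runS pi x t g :
  \sum_(h : t.+1.-tuple slot) history_weight h * g (run pi x h) =
  \sum_(h : t.-tuple slot)
     history_weight h * expect_step pi t.+1 g (run pi x h).
Proof.
rewrite (@sum_tupleS _ _ _ (fun h => history_weight h * g (run pi x h))).
apply: eq_bigr => h _; rewrite /expect_step mulr_sumr; apply: eq_bigr => b _.
by rewrite /history_weight big_cons run_cons size_tuple mulrCA mulrA.
Qed.

Lemma MWM_expect_le mwm pi x t g :
  @is_MWM N K mwm -> is_server_assignment pi -> cost_function g ->
  \sum_(h : t.-tuple slot) history_weight h * g (run mwm x h) <=
  \sum_(h : t.-tuple slot) history_weight h * g (run pi x h).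
Proof.
move=> mwmP pim; elim: t g => [|t IHt] g gF.
  by apply: ler_sum => h _; rewrite tuple0.
rewrite !expect_runS.
(* The first [t] slots are compared for the cost function that MWM induces in the last slot; only
   then is MWM replaced by [pi] in that slot. *)
apply: le_trans (IHt _ (expect_step_cost mwmP _ gF)) _ => //.
apply: ler_sum => h _; apply: ler_wpM2l; first exact: history_weight_ge0.
exact: expect_step_optimal.
Qed.

End dynamic_programming.

(** * Law of the queue length process *)

Local Open Scope classical_set_scope.

(** Singletons are finite intersections of coordinate events, and the space is countable. Hence
    events defined through arbitrary policies and cost functions are measurable. *)
Lemma measurable_tuple_nat n (S : set (n.-tuple nat)) : measurable S.
Proof.
apply: countable_measurable => [x|]; last exact: countableP.
have -> : [set x] =
    \bigcap_(i in [set: 'I_n]) ((@tnth n nat ^~ i) @^-1` [set tnth x i]).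
  apply/seteqP; split=> [_ -> //|y yx].
  by apply: eq_from_tnth => i; exact: yx.
apply: fin_bigcap_measurable => // i _.
by rewrite -[X in measurable X]setTI; exact: measurable_tnth.
Qed.

(** * Finite mixtures of probabilities *)

Section finite_mixtures.
Context d (T : measurableType d) (R : realType) (P : probability T R).

Lemma probability_finite_partition (X : finType) (Y : T -> X) (F : set T) :
  (forall y, measurable (F `&` Y @^-1` [set y])) ->
  P F = (\sum_(y : X) P (F `&` Y @^-1` [set y]))%E.
Proof.
move=> mF.
have FE : F = \bigcup_(y in [set` index_enum X]) (F `&` Y @^-1` [set y]).
  apply/seteqP; split=> [w Fw|w [y _ []//]].
  by exists (Y w) => //=; exact: mem_index_enum.
rewrite {1}FE measure_fin_bigcup //.
- by rewrite -fsbig_seq ?index_enum_uniq.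
- apply/trivIsetP => y z _ _ yz; rewrite -subset0 => w [[_ /= wy] [_ /= wz]].
  by rewrite -wy -wz eqxx in yz.
Qed.

(** Each mixture is the integral of a weighted sum of indicators. This carries a comparison made for
    each fixed initial vector over to a random one. *)
Lemma finite_mixture_le (X : finType) (u : X -> R) (F G : X -> set T) :
  (forall i, 0 <= u i) -> (forall i, measurable (F i)) ->
  (forall i, measurable (G i)) ->
  (forall w, \sum_i u i * \1_(F i) w <= \sum_i u i * \1_(G i) w) ->
  (\sum_i (u i)%:E * P (F i) <= \sum_i (u i)%:E * P (G i))%E.
Proof.
move=> u0 mF mG FG.
have mI (H : X -> set T) i : measurable (H i) ->
    measurable_fun setT (fun w => (u i)%:E * (\1_(H i) w)%:E)%E.
  by move=> mH; apply: measurable_funeM; apply/measurable_EFinP.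
have I0 (H : X -> set T) i w : (0 <= (u i)%:E * (\1_(H i) w)%:E)%E.
  by rewrite -EFinM lee_fin mulr_ge0.
have mixtureE (H : X -> set T) : (forall i, measurable (H i)) ->
    (\sum_i (u i)%:E * P (H i) =
     \int[P]_w (\sum_i (u i)%:E * (\1_(H i) w)%:E))%E.
  move=> mH; rewrite ge0_integral_sum //; last by move=> i; exact: mI.
  apply: eq_bigr => i _; rewrite ge0_integralZl_EFin ?integral_indic ?setIT //.
  exact/measurable_EFinP.
rewrite !mixtureE //; apply: ge0_le_integral => //.
- by move=> w _; apply: sume_ge0.
- by apply: emeasurable_sum => i; exact: mI.
- by apply: emeasurable_sum => i; exact: mI.
- move=> w _; under eq_bigr do rewrite -EFinM.
  by under [leRHS]eq_bigr do rewrite -EFinM; rewrite !sumEFin lee_fin.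
Qed.
End finite_mixtures.

(** * Independence and the law of the history of the first [t] slots *)

Section histories.
Context (R : realType) (d : measure_display) (T : measurableType d).
Variables (P : probability T R) (N K : nat) (p q : R).
Variables (X0 : {RV P >-> N.-tuple nat}).
Variables (C : 'I_N -> 'I_K -> nat -> {RV P >-> bool}).
Variables (A : 'I_N -> nat -> {RV P >-> bool}).
Hypotheses (p01 : 0 <= p <= 1) (q01 : 0 <= q <= 1).
Hypothesis C_bernoulli : forall n k t, (0 < t)%N ->
  distribution P (C n k t) =1 bernoulli_prob p.
Hypothesis A_bernoulli : forall n t, (0 < t)%N ->
  distribution P (A n t) =1 bernoulli_prob q.
Hypothesis indep :
  mutually_independent P (@valid_source N K) (source_events X0 C A).
Variable t : nat.

(** Position [i] holds slot [t - i], so the entries run from slot [t] down to slot 1. *)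
Definition history (w : T) : t.-tuple (slot N K) :=
  [tuple (\matrix_(n, k) C n k (t - i)%N w, [ffun n => A n (t - i)%N w])
  | i < t].

Lemma slot_of_history w j : (0 < j <= t)%N ->
  slot_of (history w) j = (\matrix_(n, k) C n k j w, [ffun n => A n j w]).
Proof.
move=> /andP[j0 jt]; rewrite /slot_of size_tuple.
have tj : (t - j < t)%N by lia.
rewrite -[(t - j)%N]/(nat_of_ord (Ordinal tj)) -tnth_nth tnth_mktuple /=.
by rewrite subKn.
Qed.

Lemma queue_process_run pi w :
  queue_process pi X0 C A t w = run pi (X0 w) (history w).
Proof.
rewrite /run size_tuple; apply: eq_queues => s st; rewrite slot_of_history //.
by move=> n; rewrite ffunE.
Qed.

(** The finitely many sources that determine the first [t] slots; [j : 'I_t] stands for slot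
    [j.+1]. *)
Let index : finType := ('I_t * ('I_N * 'I_K) + 'I_t * 'I_N + unit)%type.

Let source_of (i : index) : source N K :=
  match i with
  | inl (inl (j, (n, k))) => inl (inl (n, k, j.+1))
  | inl (inr (j, n)) => inl (inr (n, j.+1))
  | inr u => inr u
  end.

Let source_of_inj : injective source_of.
Proof.
move=> [[[j [n k]]|[j n]]|u] [[[j' [n' k']]|[j' n']]|u'] //=.
- by case=> -> -> /val_inj ->.
- by case=> -> /val_inj ->.
- by case=> ->.
Qed.

Let source_event (S : set (N.-tuple nat)) (h : seq (slot N K))
    (s : source N K) :
    set T :=
  match s with
  | inl (inl (n, k, j)) => C n k j @^-1` [set (slot_of h j).1 n k]
  | inl (inr (n, j)) => A n j @^-1` [set (slot_of h j).2 n]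
  | inr _ => X0 @^-1` S
  end.

Lemma history_weightE (h : t.-tuple (slot N K)) :
  history_weight p q h = \prod_(j < t) slot_weight p q (slot_of h j.+1).
Proof.
rewrite /history_weight (big_nth (const_mx false, [ffun=> false])) size_tuple.
(* Positions in the history run backwards in time. *)
rewrite big_mkord (reindex_inj rev_ord_inj).
by apply: eq_bigr => j _; rewrite /slot_of size_tuple.
Qed.

Lemma bernoulli_prob1 (r : R) b : 0 <= r <= 1 ->
  bernoulli_prob r [set b] = (bernoulli_pmf r b)%:E.
Proof. by move=> r01; rewrite /bernoulli_prob r01 fsbig_set1. Qed.

(** Puts the event in the form to which mutual independence applies: one event for each source. *)
Lemma history_eventE S (h : t.-tuple (slot N K)) :
  X0 @^-1` S `&` history @^-1` [set h] =
  \bigcap_(s in [set` [fset source_of i | i in index]%fset]) source_event S h s.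
Proof.
apply/seteqP; split=> [w [Sw /= wh] s /= /imfsetP[i _ ->]|w Hw].
  case: i => [[[j [n k]]|[j n]]|u] //=;
    by rewrite -wh slot_of_history ?ltn_ord //= (mxE, ffunE).
have {}Hw i : source_event S h (source_of i) w by apply: Hw; exact: in_imfset.
split; first exact: (Hw (inr tt)).
apply: eq_from_tnth => i; have it : (t - i.+1 < t)%N by have := ltn_ord i; lia.
have hi : tnth h i = slot_of h (Ordinal it).+1.
  rewrite (tnth_nth (const_mx false, [ffun=> false])) /slot_of size_tuple /=.
  congr nth; have := ltn_ord i; lia.
have ti : (t - i)%N = (Ordinal it).+1 by have := ltn_ord i; rewrite /=; lia.
rewrite tnth_mktuple hi ti [RHS]surjective_pairing; congr (_, _).
  apply/matrixP => n k; rewrite mxE.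
  exact: (Hw (inl (inl (Ordinal it, (n, k))))).
by apply/ffunP => n; rewrite ffunE; exact: (Hw (inl (inr (Ordinal it, n)))).
Qed.

Lemma measurable_history_event S (h : t.-tuple (slot N K)) :
  measurable (X0 @^-1` S `&` history @^-1` [set h]).
Proof.
rewrite history_eventE; apply: fin_bigcap_measurable => // s _.
by case: s => [[[[n k] j]|[n j]]|u] /=; apply: measurable_funPTI => //;
  exact: measurable_tuple_nat.
Qed.

Lemma probability_history S (h : t.-tuple (slot N K)) :
  P (X0 @^-1` S `&` history @^-1` [set h]) =
  ((history_weight p q h)%:E * P (X0 @^-1` S))%E.
Proof.
rewrite history_eventE indep; first last.
- move=> s _; case: s => [[[[n k] j]|[n j]]|u] /=.
  + by exists [set (slot_of h j).1 n k]; rewrite ?setTI.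
  + by exists [set (slot_of h j).2 n]; rewrite ?setTI.
  + by exists S; rewrite ?setTI //; exact: measurable_tuple_nat.
- by move=> s /= /imfsetP[[[[j [n k]]|[j n]]|u] _ ->].
rewrite big_imfset /=; last by move=> i i' _ _ /source_of_inj.
rewrite enumT !big_sumType /= big_const /= card_unit /= mule1.
congr (_ * _)%E.
rewrite history_weightE big_split /= EFinM !(big_morph EFin EFinM erefl).
congr (_ * _)%E.
- under [RHS]eq_bigr do
    rewrite /connectivity_weight pair_bigA /= (big_morph EFin EFinM erefl).
  rewrite pair_bigA; apply: eq_bigr => -[j [n k]] _ /=.
  by rewrite -bernoulli_prob1// -(C_bernoulli n k (ltn0Sn j)).
- under [RHS]eq_bigr do
    rewrite /arrival_weight /= (big_morph EFin EFinM erefl).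
  rewrite pair_bigA; apply: eq_bigr => -[j n] _ /=.
  by rewrite -bernoulli_prob1// -(A_bernoulli n (ltn0Sn j)).
Qed.

(** Once the history equals [h], the state is a function of the initial vector alone, which is
    independent of the history. *)
Lemma probability_queue_process pi (S : set (N.-tuple nat)) :
  P [set w | S (queue_process pi X0 C A t w)] =
  (\sum_(h : t.-tuple (slot N K)) (history_weight p q h)%:E *
    P (X0 @^-1` [set x | S (run pi x h)]))%E.
Proof.
have eventE h :
    [set w | S (queue_process pi X0 C A t w)] `&` history @^-1` [set h] =
    X0 @^-1` [set x | S (run pi x h)] `&` history @^-1` [set h].
  by apply/seteqP; split=> w [] /= + wh; rewrite queue_process_run wh.
rewrite (@probability_finite_partition _ _ _ _ _ history) => [|h].
  by apply: eq_bigr => h _; rewrite eventE probability_history.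
by rewrite eventE; exact: measurable_history_event.
Qed.
End histories.

Lemma cost_function_gt (R : realType) N (f : N.-tuple nat -> R) (r : R) :
  cost_function f ->
  cost_function (\1_[set x | r < f x] : N.-tuple nat -> R).
Proof.
move=> fF y x yx; rewrite !indicE ler_nat.
have [/set_mem /= rfy|//] := boolP (y \in _).
by rewrite mem_set //=; exact: lt_le_trans (fF _ _ yx).
Qed.

Theorem theorem1 (R : realType) (d : measure_display) (T : measurableType d)
  (P : probability T R) (N K : nat) (p q : R)
  (X0 : {RV P >-> N.-tuple nat})
  (C : 'I_N -> 'I_K -> nat -> {RV P >-> bool})
  (A : 'I_N -> nat -> {RV P >-> bool})
  (p01 : 0 <= p <= 1) (q01 : 0 <= q <= 1)
  (C_bernoulli : forall n k t, (0 < t)%N ->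
     distribution P (C n k t) =1 bernoulli_prob p)
  (A_bernoulli : forall n t, (0 < t)%N ->
     distribution P (A n t) =1 bernoulli_prob q)
  (indep : mutually_independent P (@valid_source N K) (source_events X0 C A))
  (pi mwm : policy N K)
  (pi_policy : is_server_assignment pi) (mwm_MWM : is_MWM mwm)
  (f : N.-tuple nat -> R) (f_cost : cost_function f)
  (t : nat) (t_ge1 : (1 <= t)%N) (r : R) :
  (P [set w | (r < f (queue_process mwm X0 C A t w))%R] <=
   P [set w | (r < f (queue_process pi X0 C A t w))%R])%E.
Proof.
have E pi' := probability_queue_process p01 q01 C_bernoulli A_bernoulli indep
  t pi' [set x | r < f x].
rewrite (E mwm) (E pi); apply: finite_mixture_le => [h|h|h|w].
- exact: history_weight_ge0.
- exact: measurable_funPTI (measurable_tuple_nat _).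
- exact: measurable_funPTI (measurable_tuple_nat _).
(* For fixed [w], both sides are averages over histories started from [X0 w] of the indicator of
   [f > r], itself a cost function. *)
- have indicE' pi' (h : t.-tuple (slot N K)) :
      \1_(X0 @^-1` [set x | r < f (run pi' x h)]) w =
      \1_[set x | r < f x] (run pi' (X0 w) h) :> R.
    by rewrite !indicE; congr (_%:R); congr nat_of_bool;
      apply/idP/idP => /set_mem wr; exact: mem_set.
  under eq_bigr do rewrite indicE'; under [leRHS]eq_bigr do rewrite indicE'.
  by apply: MWM_expect_le => //; exact: cost_function_gt.
Qed.
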